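(* Let $\mathcal A$ be a prohomological category with initial object $0$. Let $$(e\colon A\to 0,\ f\colon A\to B,\ g\colon B\to C),\quad (e'\colon A'\to 0,\ f'\colon A'\to B',\ g'\colon B'\to C'),\quad (e''\colon A''\to 0,\ f''\colon A''\to B'',\ g''\colon B''\to C'')$$ be short exact sequences in $\mathcal A$, and let $$\alpha^1\colon A\to A',\ \beta^1\colon B\to B',\ \gamma^1\colon C\to C',\qquad \alpha^2\colon A'\to A'',\ \beta^2\colon B'\to B'',\ \gamma^2\colon C'\to C''$$ be morphisms such that $(\alpha^1,\beta^1,\gamma^1)\colon(e,f,g)\to(e',f',g')$ and $(\alpha^2,\beta^2,\gamma^2)\colon(e',f',g')\to(e'',f'',g'')$ are morphisms of complexes. 1. If there exist morphisms $a\colon A\to0$ and $b\colon B\to 0$ such that $(f,f',f'')\colon(a,\alpha^1,\alpha^2)\to(b,\beta^1,\beta^2)$ is a morphism of short exact sequences, then there exists a unique morphism $c\colon C\to0$ such that $(g,g',g'')\colon(b,\beta^1,\beta^2)\to(c,\gamma^1,\gamma^2)$ is a morphism of short exact sequences. 2. If there exist morphisms $b\colon B\to0$ and $c\colon C\to 0$ such that $(g,g',g'')\colon(b,\beta^1,\beta^2)\to(c,\gamma^1,\gamma^2)$ is a morphism of short exact sequences, then there exists a unique morphism $a\colon A\to 0$ such that $(f,f',f'')\colon(a,\alpha^1,\alpha^2)\to(b,\beta^1,\beta^2)$ is a morphism of short exact sequences. 3. If there exist morphisms $a\colon A\to0$, $b\colon B\to0$, $c\colon C\to0$ such that $(f,f',f'')\colon(a,\alpha^1,\alpha^2)\to(b,\beta^1,\beta^2)$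 and $(g,g',g'')\colon(b,\beta^1,\beta^2)\to(c,\gamma^1,\gamma^2)$ are morphisms of complexes, and $(a,\alpha^1,\alpha^2)$ and $(c,\gamma^1,\gamma^2)$ are short exact sequences, then $(b,\beta^1,\beta^2)$ is a short exact sequence.
   Context: A finitely complete category is propointed if it admits an initial object $0$ and the unique morphism $0\to1$ is a universal extremal epimorphism (an extremal epimorphism all of whose pullbacks are extremal epimorphisms). A prohomological category is a propointed regular category that is protomodular in the sense of Bourn (for every morphism $v\colon Y\to X$ the pullback functor from the category of split epimorphisms with chosen section over $X$ to that over $Y$ is conservative). In a category with an initial object $0$, write $!_C\colon 0\to C$ for the unique morphism. A complex is a triple of morphisms $(u\colon X\to0,\ v\colon X\to Y,\ w\colon Y\to Z)$ such that $w\circ v=!_Z\circ u$. A morphism of complexes $(u,v,w)\to(u',v',w')$ is a triple $(\xi\colon X\to X',\eta\colon Y\to Y',\zeta\colon Z\to Z')$ such that $u'\circ\xi=u$, $\eta\circ v=v'\circ\xi$ and $\zeta\circ w=w'\circ\eta$. A complex $(u,v,w)$ is a short exact sequence if the commutative square $w\circ v=!_Z\circ u$ is both a pullback and a pushout. A morphism of short exact sequences is a morphism of complexes whose source and target are short exact sequences. *)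

(* Defs.v *)
From Stdlib Require Import ssreflect ssrfun ssrbool FinFun ClassicalEpsilon ProofIrrelevance.

Set Implicit Arguments.
Unset Strict Implicit.
Unset Printing Implicit Defensive.

Declare Scope cat_scope.
Delimit Scope cat_scope with cat.
Open Scope cat_scope.

Record category := Category {
  obj :> Type;
  hom : obj -> obj -> Type;
  id : forall X, hom X X;
  comp : forall X Y Z, hom Y Z -> hom X Y -> hom X Z;
  comp_id_l : forall X Y (f : hom X Y), comp (id Y) f = f;
  comp_id_r : forall X Y (f : hom X Y), comp f (id X) = f;
  comp_assoc : forall W X Y Z (h : hom Y Z) (g : hom X Y) (f : hom W X),
    comp h (comp g f) = comp (comp h g) f
}.

Arguments id {c} X.
Arguments comp {c X Y Z} g f : rename.

Notation "X ~> Y" := (hom X Y) (at level 90, right associativity) : cat_scope.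
Notation "g ∘ f" := (comp g f) (at level 40, left associativity) : cat_scope.

Record functor (J C : category) := Functor {
  fobj :> J -> C;
  fmap : forall X Y, (X ~> Y) -> (fobj X ~> fobj Y);
  fmap_id : forall X, fmap (id X) = id (fobj X);
  fmap_comp : forall X Y Z (g : Y ~> Z) (f : X ~> Y),
    fmap (g ∘ f) = fmap g ∘ fmap f
}.

Section Morphisms.
Variable C : category.
Implicit Types X Y Z P Q S : C.

Definition is_iso X Y (f : X ~> Y) :=
  exists g : Y ~> X, g ∘ f = id X /\ f ∘ g = id Y.

Definition is_mono X Y (f : X ~> Y) :=
  forall W (g h : W ~> X), f ∘ g = f ∘ h -> g = h.

Definition is_epi X Y (f : X ~> Y) :=
  forall Z (g h : Y ~> Z), g ∘ f = h ∘ f -> g = h.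

Definition is_extremal_epi X Y (f : X ~> Y) :=
  is_epi f /\
  forall M (m : M ~> Y) (g : X ~> M), is_mono m -> f = m ∘ g -> is_iso m.

(*        p2
      P -----> Y
      | p1     | g
      v        v
      X -----> S
          f                *)
Definition is_pullback P X Y S
    (p1 : P ~> X) (p2 : P ~> Y) (f : X ~> S) (g : Y ~> S) :=
  f ∘ p1 = g ∘ p2 /\
  forall Q (q1 : Q ~> X) (q2 : Q ~> Y), f ∘ q1 = g ∘ q2 ->
    exists! h : Q ~> P, p1 ∘ h = q1 /\ p2 ∘ h = q2.

(*        g
      S -----> Y
      | f      | i2
      v        v
      X -----> P
          i1               *)
Definition is_pushout S X Y P
    (f : S ~> X) (g : S ~> Y) (i1 : X ~> P) (i2 : Y ~> P) :=
  i1 ∘ f = i2 ∘ g /\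
  forall Q (q1 : X ~> Q) (q2 : Y ~> Q), q1 ∘ f = q2 ∘ g ->
    exists! h : P ~> Q, h ∘ i1 = q1 /\ h ∘ i2 = q2.

Definition is_coequalizer X Y Q (f g : X ~> Y) (q : Y ~> Q) :=
  q ∘ f = q ∘ g /\
  forall Z (z : Y ~> Z), z ∘ f = z ∘ g -> exists! h : Q ~> Z, h ∘ q = z.

Definition is_regular_epi Y Q (q : Y ~> Q) :=
  exists X (f g : X ~> Y), is_coequalizer f g q.

Definition is_universal_extremal_epi X S (f : X ~> S) :=
  is_extremal_epi f /\
  forall P Y (p1 : P ~> X) (p2 : P ~> Y) (g : Y ~> S),
    is_pullback p1 p2 f g -> is_extremal_epi p2.

Record initial_object := InitialObject {
  init_obj :> C;
  init_map : forall X, init_obj ~> X;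
  init_uniq : forall X (f : init_obj ~> X), f = init_map X
}.

Definition is_terminal T := forall X, exists! f : X ~> T, True.

End Morphisms.

Notation "!_[ O ] X" := (init_map O X)
  (at level 8, X at level 8, format "!_[ O ] X") : cat_scope.

Definition is_limit (J C : category) (F : functor J C)
    (L : C) (p : forall j, L ~> F j) :=
  (forall i j (u : i ~> j), fmap F u ∘ p i = p j) /\
  forall (Q : C) (q : forall j, Q ~> F j),
    (forall i j (u : i ~> j), fmap F u ∘ q i = q j) ->
    exists! h : Q ~> L, forall j, p j ∘ h = q j.

Definition finite_category (J : category) :=
  Finite J /\ forall i j : J, Finite (i ~> j).

Definition finitely_complete (C : category) :=
  forall J : category, finite_category J -> forall F : functor J C,
    exists (L : C) (p : forall j, L ~> F j), is_limit p.

Definition regular (C : category) :=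
  [/\ finitely_complete C,
      forall (X Y K : C) (f : X ~> Y) (p1 p2 : K ~> X),
        is_pullback p1 p2 f f ->
        exists (Q : C) (q : X ~> Q), is_coequalizer p1 p2 q
    & forall (P X Y S : C)
        (p1 : P ~> X) (p2 : P ~> Y) (f : X ~> S) (g : Y ~> S),
        is_pullback p1 p2 f g -> is_regular_epi f -> is_regular_epi p2].

Definition propointed (C : category) :=
  finitely_complete C /\
  exists (O : initial_object C) (T : C),
    is_terminal T /\ is_universal_extremal_epi !_[O] T.

Definition conservative (C D : category) (F : functor C D) :=
  forall (X Y : C) (f : X ~> Y), is_iso (fmap F f) -> is_iso f.

Section Points.
Variables (C : category) (X : C).

Record point := Point {
  pt_obj : C;
  pt_proj : pt_obj ~> X;
  pt_sec : X ~> pt_obj;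
  pt_split : pt_proj ∘ pt_sec = id X
}.

Record point_hom (P Q : point) := PointHom {
  pt_map :> pt_obj P ~> pt_obj Q;
  pt_map_proj : pt_proj Q ∘ pt_map = pt_proj P;
  pt_map_sec : pt_map ∘ pt_sec P = pt_sec Q
}.

Lemma point_hom_eq P Q (h k : point_hom P Q) : pt_map h = pt_map k -> h = k.
Proof.
case: h k => h h1 h2 [k k1 k2] /= e; subst k.
by rewrite (proof_irrelevance _ h1 k1) (proof_irrelevance _ h2 k2).
Qed.

Definition point_id P : point_hom P P :=
  PointHom (comp_id_r (pt_proj P)) (comp_id_l (pt_sec P)).

Definition point_comp P Q R (k : point_hom Q R) (h : point_hom P Q) :
  point_hom P R.
Proof.
refine (@PointHom P R (pt_map k ∘ pt_map h) _ _).
- by rewrite comp_assoc !pt_map_proj.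
- by rewrite -comp_assoc !pt_map_sec.
Defined.

Definition points : category.
Proof.
refine (@Category point point_hom point_id point_comp _ _ _).
- by move=> P Q f; apply: point_hom_eq; apply: comp_id_l.
- by move=> P Q f; apply: point_hom_eq; apply: comp_id_r.
- by move=> P Q R S h g f; apply: point_hom_eq; apply: comp_assoc.
Defined.

End Points.

Record pullback_of (C : category) (X Y S : C) (f : X ~> S) (g : Y ~> S) :=
  PullbackOf {
    pb_obj : C;
    pb_fst : pb_obj ~> X;
    pb_snd : pb_obj ~> Y;
    pb_universal : is_pullback pb_fst pb_snd f g
  }.

Section PullbackPair.
Variables (C : category) (X Y S : C) (f : X ~> S) (g : Y ~> S).
Variable pb : pullback_of f g.

Definition pb_pair Q (q1 : Q ~> X) (q2 : Q ~> Y) (e : f ∘ q1 = g ∘ q2) :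
    Q ~> pb_obj pb :=
  proj1_sig (constructive_definite_description _
    (proj2 (pb_universal pb) Q q1 q2 e)).

Lemma pb_pairP Q (q1 : Q ~> X) (q2 : Q ~> Y) (e : f ∘ q1 = g ∘ q2) :
  pb_fst pb ∘ pb_pair e = q1 /\ pb_snd pb ∘ pb_pair e = q2.
Proof. by rewrite /pb_pair; case: constructive_definite_description. Qed.

Lemma pb_ext Q (h k : Q ~> pb_obj pb) :
  pb_fst pb ∘ h = pb_fst pb ∘ k -> pb_snd pb ∘ h = pb_snd pb ∘ k -> h = k.
Proof.
move=> e1 e2; have [sq U] := pb_universal pb.
have e : f ∘ (pb_fst pb ∘ k) = g ∘ (pb_snd pb ∘ k).
  by rewrite !comp_assoc sq.
have [m [_ um]] := U _ _ _ e.
by rewrite -(um h (conj e1 e2)) -(um k (conj eq_refl eq_refl)).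
Qed.

End PullbackPair.

Section PullbackFunctor.
Variables (C : category) (X Y : C) (v : Y ~> X).
Variable pb : forall P : point X, pullback_of (pt_proj P) v.

Lemma pb_sec_eq (P : point X) : pt_proj P ∘ (pt_sec P ∘ v) = v ∘ id Y.
Proof. by rewrite comp_assoc pt_split comp_id_l comp_id_r. Qed.

Definition pb_point (P : point X) : point Y :=
  {| pt_obj := pb_obj (pb P);
     pt_proj := pb_snd (pb P);
     pt_sec := pb_pair (pb P) (pb_sec_eq P);
     pt_split := proj2 (pb_pairP (pb P) (pb_sec_eq P)) |}.

Section OnMorphisms.
Variables (P Q : point X) (h : point_hom P Q).

Lemma pb_map_eq :
  pt_proj Q ∘ (pt_map h ∘ pb_fst (pb P)) = v ∘ pb_snd (pb P).
Proof.
by rewrite comp_assoc pt_map_proj; case: (pb_universal (pb P)).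
Qed.

Lemma pb_map_sec :
  pb_pair (pb Q) pb_map_eq ∘ pt_sec (pb_point P) = pt_sec (pb_point Q).
Proof.
rewrite /=; apply: pb_ext.
- rewrite comp_assoc (proj1 (pb_pairP (pb Q) _)) -comp_assoc.
  rewrite (proj1 (pb_pairP (pb P) _)) (proj1 (pb_pairP (pb Q) _)).
  by rewrite comp_assoc pt_map_sec.
- by rewrite comp_assoc !(proj2 (pb_pairP _ _)).
Qed.

Definition pb_point_hom : point_hom (pb_point P) (pb_point Q) :=
  {| pt_map := pb_pair (pb Q) pb_map_eq : pt_obj (pb_point P) ~> pt_obj (pb_point Q);
     pt_map_proj := proj2 (pb_pairP (pb Q) pb_map_eq);
     pt_map_sec := pb_map_sec |}.

End OnMorphisms.

Definition pullback_functor : functor (points X) (points Y).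
Proof.
refine (@Functor (points X) (points Y) pb_point pb_point_hom _ _).
- move=> P; apply: point_hom_eq => /=; apply: pb_ext.
  + by rewrite (proj1 (pb_pairP _ _)) comp_id_l comp_id_r.
  + by rewrite (proj2 (pb_pairP _ _)) comp_id_r.
- move=> P Q R k h; apply: point_hom_eq => /=; apply: pb_ext.
  + rewrite comp_assoc !(proj1 (pb_pairP _ _)) -!comp_assoc.
    by rewrite (proj1 (pb_pairP _ _)).
  + by rewrite comp_assoc !(proj2 (pb_pairP _ _)).
Defined.

End PullbackFunctor.

(* The pullback functor along v is determined up to isomorphism by a choice of
   pullbacks, and its conservativity does not depend on that choice. *)
Definition protomodular (C : category) :=
  forall (X Y : C) (v : Y ~> X)
    (pb : forall P : point X, pullback_of (pt_proj P) v),
    conservative (pullback_functor pb).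

Definition prohomological (C : category) :=
  [/\ propointed C, regular C & protomodular C].

Section Complexes.
Variables (C : category) (O : initial_object C).

Definition is_complex (X Y Z : C) (u : X ~> O) (v : X ~> Y) (w : Y ~> Z) :=
  w ∘ v = !_[O] Z ∘ u.

Definition is_complex_morphism (X Y Z X' Y' Z' : C)
    (u : X ~> O) (v : X ~> Y) (w : Y ~> Z)
    (u' : X' ~> O) (v' : X' ~> Y') (w' : Y' ~> Z')
    (xi : X ~> X') (eta : Y ~> Y') (zeta : Z ~> Z') :=
  [/\ is_complex u v w, is_complex u' v' w',
      u' ∘ xi = u, eta ∘ v = v' ∘ xi & zeta ∘ w = w' ∘ eta].

Definition is_short_exact (X Y Z : C) (u : X ~> O) (v : X ~> Y) (w : Y ~> Z) :=
  [/\ is_complex u v w,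
      is_pullback v u w !_[O] Z & is_pushout v u w !_[O] Z].

Definition is_short_exact_morphism (X Y Z X' Y' Z' : C)
    (u : X ~> O) (v : X ~> Y) (w : Y ~> Z)
    (u' : X' ~> O) (v' : X' ~> Y') (w' : Y' ~> Z')
    (xi : X ~> X') (eta : Y ~> Y') (zeta : Z ~> Z') :=
  [/\ is_short_exact u v w, is_short_exact u' v' w'
    & is_complex_morphism u v w u' v' w' xi eta zeta].

End Complexes.

(* Main.v *)
From Stdlib Require Import ssreflect ssrfun ssrbool FinFun ClassicalEpsilon.
Require Import Defs.

(* In a regular protomodular category, [(u, v, w)] is short exact iff [(v, u)]
   is the pullback of [w] along [0 -> Z] and [w] is a regular epimorphism: the
   map [u] is split by [0 -> X], so that [w] is a coequalizer of [v] and
   [v ! u]; conversely the kernel pair of [w] is generated by its diagonal and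
   by [v].
   The two nontrivial tools are the short five lemma and its variant for regular
   epimorphisms; the latter shows that [B' -> B'' x_C'' C'] is a regular
   epimorphism as soon as [A' -> A''] (or [B -> C]) is one. This yields the
   missing lifts, and the rest is a chase with generalized elements. The map
   [A -> 0] of the left column is forced to be [e], since
   [e = e'' alpha2 alpha1]. *)

Set Implicit Arguments.
Unset Strict Implicit.
Unset Printing Implicit Defensive.

(** * Composition with generalized elements, and the initial object *)

Section Composition.
Variable C : category.

(** Together with [comp_eq1], this lets a commuting square or triangle be rewritten inside a
    right-nested composite, the form in which generalized elements are chased below. *)
Lemma comp_eq (W X Y Y' Z : C) (g : Y ~> Z) (f : X ~> Y) (k : Y' ~> Z) (l : X ~> Y')
  (x : W ~> X) : g ∘ f = k ∘ l -> g ∘ (f ∘ x) = k ∘ (l ∘ x).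
Proof. by move=> e; rewrite !comp_assoc e. Qed.

Lemma comp_eq1 (W X Y Z : C) (g : Y ~> Z) (f : X ~> Y) (k : X ~> Z) (x : W ~> X) :
  g ∘ f = k -> g ∘ (f ∘ x) = k ∘ x.
Proof. by move=> e; rewrite comp_assoc e. Qed.
End Composition.

Section Initial.
Variables (C : category) (O : initial_object C).

Lemma init_ext (X : C) (f g : O ~> X) : f = g.
Proof. by rewrite (init_uniq f) (init_uniq g). Qed.

Lemma comp_init (X Y : C) (f : X ~> Y) : f ∘ !_[O] X = !_[O] Y.
Proof. exact: init_ext. Qed.

Lemma comp_initA (W X Y : C) (f : X ~> Y) (z : W ~> O) :
  f ∘ (!_[O] X ∘ z) = !_[O] Y ∘ z.
Proof. by rewrite comp_assoc comp_init. Qed.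

(** The composite [u ∘ !_[O] X] is an endomorphism of [O], hence the identity: every map to [O] is
    split. *)
Lemma comp_to_init (W X : C) (u : X ~> O) (z : W ~> O) :
  u ∘ (!_[O] X ∘ z) = z.
Proof. by rewrite comp_assoc (init_ext (u ∘ _) (id O)) comp_id_l. Qed.
End Initial.

(** * Pullbacks as limits over the finite cospan shape *)

Inductive cospan_obj := cospan_left | cospan_right | cospan_apex.

Definition cospan_hom (i j : cospan_obj) : Type :=
  match i, j with
  | cospan_left, cospan_left | cospan_right, cospan_right
  | cospan_apex, cospan_apex
  | cospan_left, cospan_apex | cospan_right, cospan_apex => unit
  | _, _ => Empty_set
  end.

Definition cospan_id (i : cospan_obj) : cospan_hom i i.
Proof. by case: i; exact: tt. Defined.

Definition cospan_comp (i j k : cospan_obj) :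
  cospan_hom j k -> cospan_hom i j -> cospan_hom i k.
Proof. by case: i; case: j; case: k; case; case; exact: tt. Defined.

Definition cospan : category.
Proof.
refine (@Category cospan_obj cospan_hom cospan_id cospan_comp _ _ _).
- by do 2 case; case.
- by do 2 case; case.
- by do 4 case; move=> [] [] [].
Defined.

Lemma cospan_finite : finite_category cospan.
Proof.
split.
- by exists (cospan_left :: cospan_right :: cospan_apex :: nil)%list; case => /=; auto.
- by do 2 case; (exists (tt :: nil)%list; case; left) || (exists nil; case).
Qed.

Definition cospan_functor (C : category) (X Y S : C) (f : X ~> S) (g : Y ~> S) :
  functor cospan C.
Proof.
refine (@Functor cospan C
  (fun i => match i with cospan_left => X | cospan_right => Y | cospan_apex => S end)
  (fun i j => match i, j with
   | cospan_left, cospan_left => fun=> id X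
   | cospan_right, cospan_right => fun=> id Y
   | cospan_apex, cospan_apex => fun=> id S
   | cospan_left, cospan_apex => fun=> f
   | cospan_right, cospan_apex => fun=> g
   | _, _ => fun x : Empty_set => match x with end
   end) _ _).
- by case.
- by do 3 case; move=> [] []; rewrite ?comp_id_l ?comp_id_r.
Defined.

Definition has_pullbacks (C : category) :=
  forall (X Y S : C) (f : X ~> S) (g : Y ~> S),
    exists (P : C) (p1 : P ~> X) (p2 : P ~> Y), is_pullback p1 p2 f g.

Lemma finitely_complete_pullbacks (C : category) :
  finitely_complete C -> has_pullbacks C.
Proof.
move=> FC X Y S f g.
have [L [p [cone univ]]] := FC _ cospan_finite (cospan_functor f g).
have El := cone cospan_left cospan_apex tt.
have Er := cone cospan_right cospan_apex tt.
exists L, (p cospan_left), (p cospan_right); split; first by rewrite El Er.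
move=> Q q1 q2 e.
pose q := fun i : cospan => match i return Q ~> cospan_functor f g i with
  cospan_left => q1 | cospan_right => q2 | cospan_apex => f ∘ q1 end.
have [|h [hq hu]] := univ Q q.
  by do 2 case; move=> []; rewrite /= ?comp_id_l.
exists h; split; first by split; [exact: hq cospan_left | exact: hq cospan_right].
move=> k [k1 k2]; apply: hu; case => //=.
by rewrite -El -comp_assoc k1.
Qed.

(** * Elementary properties of pullbacks *)

Section Pullbacks.
Variable C : category.
Implicit Types P X Y S W : C.

Lemma pullback_lift P X Y S (p1 : P ~> X) (p2 : P ~> Y) (f : X ~> S) (g : Y ~> S)
  W (x : W ~> X) (y : W ~> Y) : is_pullback p1 p2 f g -> f ∘ x = g ∘ y ->
  exists h : W ~> P, p1 ∘ h = x /\ p2 ∘ h = y.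
Proof. by case=> _ univ /univ [h [hP _]]; exists h. Qed.

Lemma pullback_ext P X Y S (p1 : P ~> X) (p2 : P ~> Y) (f : X ~> S) (g : Y ~> S)
  W (h k : W ~> P) : is_pullback p1 p2 f g ->
  p1 ∘ h = p1 ∘ k -> p2 ∘ h = p2 ∘ k -> h = k.
Proof.
case=> sq univ e1 e2.
have [|m [_ mu]] := univ W (p1 ∘ k) (p2 ∘ k); first exact: comp_eq.
by rewrite -(mu h (conj e1 e2)) -(mu k (conj erefl erefl)).
Qed.

Lemma is_pullback_intro P X Y S (p1 : P ~> X) (p2 : P ~> Y)
  (f : X ~> S) (g : Y ~> S) : f ∘ p1 = g ∘ p2 ->
  (forall W (x : W ~> X) (y : W ~> Y), f ∘ x = g ∘ y ->
     exists h : W ~> P, p1 ∘ h = x /\ p2 ∘ h = y) ->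
  (forall W (h k : W ~> P), p1 ∘ h = p1 ∘ k -> p2 ∘ h = p2 ∘ k -> h = k) ->
  is_pullback p1 p2 f g.
Proof.
move=> sq ex ext; split=> // Q q1 q2 /ex [h [h1 h2]].
by exists h; split=> // k [k1 k2]; apply: ext; rewrite ?h1 ?h2 ?k1 ?k2.
Qed.

Lemma pullback_mono P X Y S (p1 : P ~> X) (p2 : P ~> Y) (f : X ~> S) (g : Y ~> S) :
  is_pullback p1 p2 f g -> is_mono f -> is_mono p2.
Proof.
move=> pb fm W h k e2; apply: (pullback_ext pb) => //; apply: fm.
by have [sq _] := pb; rewrite !(comp_eq _ sq) e2.
Qed.

(** Serves to transfer the universal property from a chosen pullback to a given square once the
    comparison map is known to be invertible. *)
Lemma iso_pullback P P' X Y S (i : P' ~> P) (p1 : P ~> X) (p2 : P ~> Y)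
  (f : X ~> S) (g : Y ~> S) : is_iso i -> is_pullback p1 p2 f g ->
  is_pullback (p1 ∘ i) (p2 ∘ i) f g.
Proof.
move=> [j [ji ij]] pb; have [sq _] := pb.
apply: is_pullback_intro; first exact: comp_eq.
- move=> W x y /(pullback_lift pb) [h [h1 h2]]; exists (j ∘ h).
  by rewrite -!comp_assoc (comp_eq1 _ ij) comp_id_l.
- move=> W h k; rewrite -!comp_assoc => e1 e2.
  have e : i ∘ h = i ∘ k by apply: (pullback_ext pb).
  by rewrite -(comp_id_l h) -(comp_id_l k) -ji -!comp_assoc e.
Qed.
End Pullbacks.

(** * Covers and regular epimorphisms *)

Definition is_cover (C : category) (X Y : C) (f : X ~> Y) :=
  forall M (m : M ~> Y) (g : X ~> M), is_mono m -> f = m ∘ g -> is_iso m.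

Section RegularEpis.
Variable C : category.
Implicit Types W X Y Z : C.

Lemma regular_epi_epi X Y (q : X ~> Y) : is_regular_epi q -> is_epi q.
Proof.
move=> [R [r1 [r2 [e univ]]]] Z h k hk.
have [|l [_ lu]] := univ Z (k ∘ q); first by rewrite -!comp_assoc e.
by rewrite -(lu h hk) (lu k).
Qed.

Lemma regular_epi_desc X Y Z (q : X ~> Y) (z : X ~> Z) : is_regular_epi q ->
  (forall W (x y : W ~> X), q ∘ x = q ∘ y -> z ∘ x = z ∘ y) ->
  exists h : Y ~> Z, h ∘ q = z.
Proof.
move=> [R [r1 [r2 [e univ]]]] zP.
by have [h [hq _]] := univ Z z (zP _ _ _ e); exists h.
Qed.

(** As [m] is mono, [k] descends along [q] to a section of [m], and a mono with a section is
    invertible. *)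
Lemma regular_epi_cover X Y (q : X ~> Y) : is_regular_epi q -> is_cover q.
Proof.
move=> qr M m k mm qE.
have [W x y exy|h hq] := regular_epi_desc (z := k) qr.
  by apply: mm; rewrite !comp_assoc -qE.
have mh : m ∘ h = id Y.
  by apply: (regular_epi_epi qr); rewrite -comp_assoc hq comp_id_l.
by exists h; split=> //; apply: mm; rewrite (comp_eq1 _ mh) comp_id_l comp_id_r.
Qed.

Lemma iso_comp_regular_epi X Y Z (i : Y ~> Z) (q : X ~> Y) :
  is_iso i -> is_regular_epi q -> is_regular_epi (i ∘ q).
Proof.
move=> [j [ji ij]] [R [r1 [r2 [e univ]]]]; exists R, r1, r2; split.
  by rewrite -!comp_assoc e.
move=> V v /univ [h [hq hu]]; exists (h ∘ j); split.
  by rewrite -comp_assoc (comp_eq1 _ ji) comp_id_l.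
move=> k; rewrite comp_assoc => /hu ->.
by rewrite -comp_assoc ij comp_id_r.
Qed.

Lemma cover_cancel X Y Z (g : Y ~> Z) (f : X ~> Y) :
  is_cover (g ∘ f) -> is_cover g.
Proof.
move=> gfc M m k mm gE; apply: (gfc M m (k ∘ f)) => //.
by rewrite comp_assoc gE.
Qed.

Lemma mono_cover_iso X Y (f : X ~> Y) : is_mono f -> is_cover f -> is_iso f.
Proof. by move=> fm /(_ X f (id X)); apply; rewrite ?comp_id_r. Qed.

Lemma iso_cover X Y (f : X ~> Y) : is_iso f -> is_cover f.
Proof.
move=> [g [gf fg]] M m k mm fE; exists (k ∘ g); split.
- by apply: mm; rewrite -comp_assoc (comp_eq1 _ (esym fE)) (comp_eq1 _ fg)
    comp_id_l comp_id_r.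
- by rewrite comp_assoc -fE.
Qed.
End RegularEpis.

(** * Images and local lifting along covers in a regular category *)

Section RegularCategory.
Variables (C : category) (regC : regular C).
Implicit Types W X Y Z : C.

Lemma regular_pullbacks : has_pullbacks C.
Proof. by case: regC => FC _ _; apply: finitely_complete_pullbacks. Qed.

Lemma regular_epi_lift X Y W (q : X ~> Y) (y : W ~> Y) : is_regular_epi q ->
  exists (V : C) (k : V ~> W) (x : V ~> X), is_regular_epi k /\ q ∘ x = y ∘ k.
Proof.
move=> qr; have [P [p1 [p2 pb]]] := regular_pullbacks q y.
exists P, p2, p1; split; last by case: pb.
by have [_ _ st] := regC; exact: st pb qr.
Qed.

(** [I] is the quotient of the kernel pair of [f]. For [m] to be mono, two elements of [I] that it
    identifies are lifted to [X] over a common cover; the lifts form an element of the kernel pair,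
    which [q] collapses. *)
Lemma image_factorization X Y (f : X ~> Y) :
  exists (I : C) (m : I ~> Y) (q : X ~> I),
    [/\ is_mono m, is_regular_epi q & f = m ∘ q].
Proof.
have [K [p1 [p2 pb]]] := regular_pullbacks f f.
have [_ cq _] := regC; have [I [q qc]] := cq _ _ _ _ _ _ pb.
have qr : is_regular_epi q by exists K, p1, p2.
have [sq univ] := qc.
have [|m [mq _]] := univ _ f; first by case: pb.
exists I, m, q; split=> // W x y mxy.
have [V [k [x1 [kr ex]]]] := regular_epi_lift x qr.
have [V' [k' [y1 [kr' ey]]]] := regular_epi_lift (y ∘ k) qr.
apply: (regular_epi_epi kr); apply: (regular_epi_epi kr').
rewrite -ey -ex -comp_assoc.
have [|h [h1 h2]] := @pullback_lift _ _ _ _ _ _ _ _ _ _ (x1 ∘ k') y1 pb.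
  by rewrite -mq -!comp_assoc ey (comp_eq _ ex) -!comp_assoc (comp_eq _ mxy).
by rewrite -h1 -h2 (comp_eq _ sq).
Qed.

Lemma cover_regular_epi X Y (f : X ~> Y) : is_cover f -> is_regular_epi f.
Proof.
move=> fc; have [I [m [q [mm qr fE]]]] := image_factorization f.
by rewrite fE; apply: iso_comp_regular_epi => //; apply: fc fE.
Qed.

Lemma cover_epi X Y (f : X ~> Y) : is_cover f -> is_epi f.
Proof. by move=> /cover_regular_epi /regular_epi_epi. Qed.

Lemma cover_lift X Y W (q : X ~> Y) (y : W ~> Y) : is_cover q ->
  exists (V : C) (k : V ~> W) (x : V ~> X), is_cover k /\ q ∘ x = y ∘ k.
Proof.
move=> /cover_regular_epi /(regular_epi_lift y) [V [k [x [kr e]]]].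
by exists V, k, x; split=> //; apply: regular_epi_cover.
Qed.

(** The generic element [id Y] suffices: its lift [x] makes [q ∘ x] a cover, and [cover_cancel]
    applies. *)
Lemma cover_of_lift X Y (q : X ~> Y) :
  (forall W (y : W ~> Y),
     exists (V : C) (k : V ~> W) (x : V ~> X), is_cover k /\ q ∘ x = y ∘ k) ->
  is_cover q.
Proof.
move=> /(_ Y (id Y)) [V [k [x [kc]]]]; rewrite comp_id_l => e.
by apply: (@cover_cancel _ _ _ _ q x); rewrite e.
Qed.

(** The cover [k] factors through the pullback of the mono [m] along [y], so that pullback is
    invertible and its inverse yields [z]. *)
Lemma mono_lift_along_cover V W X Y (m : X ~> Y) (k : V ~> W) (x : V ~> X) (y : W ~> Y) :
  is_mono m -> is_cover k -> m ∘ x = y ∘ k -> exists z : W ~> X, m ∘ z = y.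
Proof.
move=> mm kc e; have [P [p1 [p2 pb]]] := regular_pullbacks m y.
have [h [_ h2]] := pullback_lift pb e.
have [j [_ pj]] := kc _ _ _ (pullback_mono pb mm) (esym h2).
have [sq _] := pb.
by exists (p1 ∘ j); rewrite (comp_eq _ sq) pj comp_id_r.
Qed.

Lemma cover_comp X Y Z (g : Y ~> Z) (f : X ~> Y) :
  is_cover g -> is_cover f -> is_cover (g ∘ f).
Proof.
move=> gc fc M m k mm /esym e.
have [z mz] := mono_lift_along_cover mm fc e.
exact: gc mm (esym mz).
Qed.

Lemma cover_pullback P X Y Z (p1 : P ~> X) (p2 : P ~> Y) (f : X ~> Z) (g : Y ~> Z) :
  is_pullback p1 p2 f g -> is_cover f -> is_cover p2.
Proof.
move=> pb /cover_regular_epi fr; apply: regular_epi_cover.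
by have [_ _ st] := regC; exact: st pb fr.
Qed.

End RegularCategory.

(** * Protomodularity in terms of generalized elements *)

Section Protomodular.
Variable C : category.
Implicit Types P Q W X Y Z : C.

(* [h], as a morphism over [X], becomes an isomorphism (resp. a cover) after
   pulling back along [v]. *)
Definition is_iso_over P Q X Y (v : Y ~> X) (q : Q ~> X) (h : P ~> Q) :=
  forall W (y : W ~> Y) (t : W ~> Q), q ∘ t = v ∘ y ->
    exists! s : W ~> P, h ∘ s = t.

Definition is_cover_over P Q X Y (v : Y ~> X) (q : Q ~> X) (h : P ~> Q) :=
  forall W (y : W ~> Y) (t : W ~> Q), q ∘ t = v ∘ y ->
    exists (V : C) (k : V ~> W) (s : V ~> P), is_cover k /\ h ∘ s = t ∘ k.

Lemma is_iso_over_inj P Q X Y (v : Y ~> X) (q : Q ~> X) (h : P ~> Q)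
  W (y : W ~> Y) (s s' : W ~> P) : is_iso_over v q h ->
  h ∘ s = h ∘ s' -> q ∘ (h ∘ s') = v ∘ y -> s = s'.
Proof. by move=> hv e /hv [l [_ lu]]; rewrite -(lu s e) -(lu s' erefl). Qed.

Lemma point_hom_iso X (P Q : point X) (h : point_hom P Q) :
  is_iso (pt_map h) -> @is_iso (points X) P Q h.
Proof.
move=> [k [kh hk]].
have kp : pt_proj P ∘ k = pt_proj Q.
  by rewrite -(pt_map_proj h) -comp_assoc hk comp_id_r.
have ks : k ∘ pt_sec Q = pt_sec P.
  by rewrite -(pt_map_sec h) comp_assoc kh comp_id_l.
by exists (PointHom kp ks); split; apply: point_hom_eq.
Qed.

(** Unique lifting of the elements lying over [Y] means that the pullback of [h] along [v] is
    invertible, so conservativity applies. *)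
Lemma protomodular_iso_over (pbC : has_pullbacks C) (protoC : protomodular C)
  P Q X Y (v : Y ~> X) (p : P ~> X) (s : X ~> P) (q : Q ~> X) (t : X ~> Q)
  (h : P ~> Q) : p ∘ s = id X -> q ∘ t = id X -> q ∘ h = p -> h ∘ s = t ->
  is_iso_over v q h -> is_iso h.
Proof.
move=> ps qt qh hs hv.
(* [protomodular] takes a chosen pullback for every point, while [has_pullbacks] only asserts
   existence; indefinite description makes the choice. *)
have pb (R : point X) : pullback_of (pt_proj R) v.
  have /constructive_indefinite_description [Z] := pbC _ _ _ (pt_proj R) v.
  move=> /constructive_indefinite_description [z1].
  move=> /constructive_indefinite_description [z2 zP].
  exact: (PullbackOf zP).
pose P' := Point ps; pose Q' := Point qt.
pose h' := @PointHom _ _ P' Q' h qh hs.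
suff /protoC [k [kh hk]] : is_iso (fmap (pullback_functor pb) h').
  exists (pt_map k); split; first exact: (f_equal (@pt_map _ _ P' P') kh).
  exact: (f_equal (@pt_map _ _ Q' Q') hk).
apply: point_hom_iso => /=.
have [sqP _] := pb_universal (pb P'); have [sqQ _] := pb_universal (pb Q').
(* The lift [s0] of the projection to [Q], paired with the projection to [Y], is the inverse of the
   pulled back [h]. *)
have [s0 [hs0 s0u]] := hv _ _ _ sqQ.
have e : p ∘ s0 = v ∘ pb_snd (pb Q') by rewrite -qh -comp_assoc hs0.
have [e1 e2] := pb_pairP (pb P') e.
have [d1 d2] := pb_pairP (pb Q') (pb_map_eq pb h').
exists (pb_pair (pb P') e); split; apply: pb_ext.
- rewrite comp_id_r (comp_eq1 _ e1); apply: (is_iso_over_inj hv (y := pb_snd (pb P'))).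
    by rewrite (comp_eq1 _ hs0) d1.
  by rewrite (comp_eq1 _ qh).
- by rewrite (comp_eq1 _ e2) d2 comp_id_r.
- by rewrite (comp_eq1 _ d1) -comp_assoc e1 hs0 comp_id_r.
- by rewrite (comp_eq1 _ d2) e2 comp_id_r.
Qed.
End Protomodular.

(** * Five lemmas and the description of short exact sequences *)

Section ShortExact.
Variables (C : category) (O : initial_object C).
Hypotheses (regC : regular C) (protoC : protomodular C).
Variables (T : C) (termT : is_terminal T).
Implicit Types K L W X Y Z : C.
Let pbC := regular_pullbacks regC.

(** Protomodularity concerns points, so [h] is first pulled back along [p = q ∘ h]. It becomes
    [H : X x_Z X -> X x_Z Y], a morphism of points over [X] whose sections are the diagonal and the
    graph of [h]. [H] is invertible over [O -> X], hence invertible, and this descends to [h]. *)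
Lemma short_five X Y Z (q : Y ~> Z) (h : X ~> Y) : is_cover (q ∘ h) ->
  is_iso_over !_[O] Z q h -> is_iso h.
Proof.
move=> pc hO; pose p := q ∘ h.
have [R [r1 [r2 pbR]]] := pbC p p; have [S [s1 [s2 pbS]]] := pbC p q.
have [sqR _] := pbR; have [sqS _] := pbS.
have [H [H1 H2]] : exists H : R ~> S, s1 ∘ H = r1 /\ s2 ∘ H = h ∘ r2.
  by apply: (pullback_lift pbS); rewrite sqR -comp_assoc.
have [dR [dR1 dR2]] : exists d : X ~> R, r1 ∘ d = id X /\ r2 ∘ d = id X.
  exact: (pullback_lift pbR).
have [dS [dS1 dS2]] : exists d : X ~> S, s1 ∘ d = id X /\ s2 ∘ d = h.
  by apply: (pullback_lift pbS); rewrite comp_id_r.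
have [H' [H'H HH']] : is_iso H.
  apply: (protomodular_iso_over pbC protoC (v := !_[O] X) dR1 dS1 H1).
    apply: (pullback_ext pbS); first by rewrite (comp_eq1 _ H1) dR1.
    by rewrite (comp_eq1 _ H2) -comp_assoc dR2 comp_id_r.
  move=> W y t ty.
  have [|s [hs su]] := hO W y (s2 ∘ t).
    by rewrite -(comp_eq _ sqS) ty comp_initA.
  have [|l [l1 l2]] := @pullback_lift _ _ _ _ _ _ _ _ _ _ (s1 ∘ t) s pbR.
    by rewrite (comp_eq _ sqS) -hs comp_assoc.
  exists l; split.
    apply: (pullback_ext pbS); first by rewrite (comp_eq1 _ H1).
    by rewrite (comp_eq1 _ H2) -comp_assoc l2.
  move=> l' Hl'; apply: (pullback_ext pbR).
    by rewrite l1 -Hl' (comp_eq1 _ H1).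
  by rewrite l2; apply: su; rewrite -Hl' (comp_eq1 _ H2) comp_assoc.
apply: mono_cover_iso.
(* If [h] identifies [a] and [b], then [H] identifies the pairs [(a, a)] and [(a, b)]. *)
- move=> W a b hab.
  have pab : p ∘ a = p ∘ b by rewrite /p -!comp_assoc hab.
  have [u [u1 u2]] : exists u : W ~> R, r1 ∘ u = a /\ r2 ∘ u = a.
    exact: (pullback_lift pbR).
  have [w [w1 w2]] := pullback_lift pbR pab.
  rewrite -u2 -w2 -(comp_id_l u) -(comp_id_l w) -H'H -!comp_assoc.
  have -> // : H ∘ u = H ∘ w.
  apply: (pullback_ext pbS); first by rewrite !(comp_eq1 _ H1) u1 w1.
  by rewrite !(comp_eq1 _ H2) -!comp_assoc u2 w2.
- apply: (@cover_cancel _ _ _ _ h r2); rewrite -H2.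
  apply: (cover_comp regC); first exact: (cover_pullback regC pbS).
  by apply: iso_cover; exists H'.
Qed.

(** The short five lemma applies to the mono part [m] of the image of [h]: a lift that exists only
    locally in [X] gives an actual lift to [I], because [m] is mono. *)
Lemma cover_five X Y Z (q : Y ~> Z) (h : X ~> Y) : is_cover (q ∘ h) ->
  is_cover_over !_[O] Z q h -> is_cover h.
Proof.
move=> pc hO; have [I [m [r [mm rr hE]]]] := image_factorization regC h.
suff mi : is_iso m.
  by rewrite hE; apply: (cover_comp regC);
    [exact: iso_cover | exact: regular_epi_cover].
apply: (short_five (q := q)).
  by apply: (@cover_cancel _ _ _ _ _ r); rewrite -comp_assoc -hE.
move=> W y t /hO [V [k [s [kc e]]]].
have [|z mz] := @mono_lift_along_cover _ regC _ _ _ _ m k (r ∘ s) t mm kc.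
  by rewrite comp_assoc -hE.
by exists z; split=> // z' mz'; apply: mm; rewrite mz mz'.
Qed.

(** The leg out of [O] in a cocone is forced, so the pushout property makes [w] a coequalizer of [v]
    and [!_[O] Y ∘ u]. *)
Lemma short_exact_cover X Y Z (u : X ~> O) (v : X ~> Y) (w : Y ~> Z) :
  is_short_exact u v w -> is_cover w.
Proof.
move=> [cx _ [_ univ]]; apply: regular_epi_cover.
exists X, v, (!_[O] Y ∘ u); split; first by rewrite comp_initA.
move=> Q z zv; have [|h [[hw _] hu]] := univ Q z !_[O] Q.
  by rewrite zv comp_initA.
exists h; split=> // h' h'w; apply: hu; split=> //; exact: comp_init.
Qed.

(** The equalizer is the pullback of the diagonal of [Y] along the pairing of [f] and [g], the
    product [Y x Y] being a pullback over [T]. *)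
Lemma equalizer_exists X Y (f g : X ~> Y) :
  exists (E : C) (m : E ~> X), [/\ is_mono m, f ∘ m = g ∘ m &
    forall W (x : W ~> X), f ∘ x = g ∘ x -> exists z : W ~> E, m ∘ z = x].
Proof.
have [t _] := termT Y.
have eqT W (a b : W ~> T) : a = b.
  by have [c [_ cu]] := termT W; rewrite -(cu a) // -(cu b).
have [P [p1 [p2 pbP]]] := pbC t t.
have [d [d1 d2]] := pullback_lift pbP (eqT Y (t ∘ id Y) (t ∘ id Y)).
have [k [k1 k2]] := pullback_lift pbP (eqT X (t ∘ f) (t ∘ g)).
have [E [n [m pbE]]] := pbC d k; have [sq _] := pbE.
have n1 : n = f ∘ m by rewrite -k1 -comp_assoc -sq (comp_eq1 _ d1) comp_id_l.
have n2 : n = g ∘ m by rewrite -k2 -comp_assoc -sq (comp_eq1 _ d2) comp_id_l.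
exists E, m; split; last 2 first.
- by rewrite -n1 -n2.
- move=> W x fx; have [|z [_ z2]] := @pullback_lift _ _ _ _ _ _ _ _ _ _ (f ∘ x) x pbE.
    apply: (pullback_ext pbP); first by rewrite (comp_eq1 _ d1) (comp_eq1 _ k1) comp_id_l.
    by rewrite (comp_eq1 _ d2) (comp_eq1 _ k2) comp_id_l.
  by exists z.
- apply: (pullback_mono pbE) => W x y dxy.
  by rewrite -(comp_id_l x) -(comp_id_l y) -d1 -!comp_assoc dxy.
Qed.

(* The kernel pair of [w] is generated by the diagonal and the kernel of [w], so
   a morphism which is trivial on the kernel coequalizes the kernel pair. *)
Lemma cover_short_exact X Y Z (u : X ~> O) (v : X ~> Y) (w : Y ~> Z) :
  is_cover w -> is_pullback v u w !_[O] Z -> is_short_exact u v w.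
Proof.
move=> wc pb; have [sq _] := pb; split=> //; split=> // Q q1 q2 e.
have [R [r1 [r2 pbR]]] := pbC w w; have [sqR _] := pbR.
have [E [m [mm em Eu]]] := equalizer_exists (q1 ∘ r1) (q1 ∘ r2).
have [d [d1 d2]] : exists d : Y ~> R, r1 ∘ d = id Y /\ r2 ∘ d = id Y.
  exact: (pullback_lift pbR).
have [|d' md'] := Eu _ d; first by rewrite -!comp_assoc d1 d2.
have [n [nm mn]] : is_iso m.
  apply: (protomodular_iso_over pbC protoC (v := !_[O] Y) (p := r1 ∘ m)
    (s := d') (q := r1) (t := d)) => //; first by rewrite -comp_assoc md'.
  move=> W y t ty.
  (* An element of the kernel pair with zero first component has its second one in the kernel [X],
     on which [q1] takes the trivial value [q2 ∘ u]. *)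
  have wt : w ∘ (r2 ∘ t) = !_[O] Z ∘ y.
    by rewrite -(comp_eq _ sqR) ty comp_initA.
  have [x [x1 x2]] := pullback_lift pb wt.
  have [|z mz] := Eu _ t.
    by rewrite -!comp_assoc ty comp_initA -x1 (comp_eq _ e) x2 (init_ext q2 !_[O] Q).
  by exists z; split=> // z' mz'; apply: mm; rewrite mz mz'.
have [W x y wxy|h hw] := regular_epi_desc (z := q1) (cover_regular_epi regC wc).
  have [l [<- <-]] := pullback_lift pbR wxy.
  by rewrite -(comp_id_l l) -mn !comp_assoc em.
exists h; split; first by split=> //; apply: init_ext.
by move=> k [kw _]; apply: (cover_epi regC wc); rewrite hw kw.
Qed.

(* If [p] is a cover and [r] induces a cover [phi] from the kernel of [p] to the
   kernel of [p'], then [X -> Z x_T Y] is a cover, being so over [O -> Z]. *)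
Lemma cover_to_pullback X Y Z V K L (p : X ~> Z) (r : X ~> Y) (p' : Y ~> V)
  (r' : Z ~> V) (k1 : K ~> X) (u1 : K ~> O) (k2 : L ~> Y) (u2 : L ~> O)
  (phi : K ~> L) : p' ∘ r = r' ∘ p -> is_cover p ->
  p ∘ k1 = !_[O] Z ∘ u1 -> is_pullback k2 u2 p' !_[O] V ->
  is_cover phi -> r ∘ k1 = k2 ∘ phi -> u2 ∘ phi = u1 ->
  forall W (z : W ~> Z) (y : W ~> Y), r' ∘ z = p' ∘ y ->
  exists (W' : C) (k : W' ~> W) (x : W' ~> X),
    [/\ is_cover k, p ∘ x = z ∘ k & r ∘ x = y ∘ k].
Proof.
move=> sq pc pk pbL phic rk uphi W z y zy.
have [P [q1 [q2 pbP]]] := pbC r' p'; have [sqP _] := pbP.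
have [h [h1 h2]] := pullback_lift pbP (esym sq).
have [t [t1 t2]] := pullback_lift pbP zy.
(* An element of [P] over [O -> Z] has its [Y]-component in the kernel [L] of [p'], and [phi] lifts
   it locally to [K]. *)
have hc : is_cover h.
  apply: (cover_five (q := q1)); first by rewrite h1.
  move=> W' o s so.
  have /(pullback_lift pbL) [l [l1 l2]] : p' ∘ (q2 ∘ s) = !_[O] V ∘ o.
    by rewrite -(comp_eq _ sqP) so comp_initA.
  have [W'' [k [x [kc xk]]]] := cover_lift regC l phic.
  exists W'', k, (k1 ∘ x); split=> //; apply: (pullback_ext pbP).
    rewrite (comp_eq1 _ h1) (comp_eq _ pk) -uphi -!comp_assoc xk.
    by rewrite (comp_eq1 _ l2) (comp_eq1 _ so) comp_assoc.
  by rewrite (comp_eq1 _ h2) (comp_eq _ rk) xk !comp_assoc -l1.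
have [W' [k [x [kc xk]]]] := cover_lift regC t hc.
exists W', k, x; split=> //.
- by rewrite -h1 -comp_assoc xk (comp_eq1 _ t1).
- by rewrite -h2 -comp_assoc xk (comp_eq1 _ t2).
Qed.
End ShortExact.

(** * Chases in the three-by-three diagram *)

Section NineLemma.
Variables (C0 : category) (O : initial_object C0).
Hypotheses (regC : regular C0) (protoC : protomodular C0).
Variables (T : C0) (termT : is_terminal T).
Variables (A B C A' B' C' A'' B'' C'' : C0)
  (e : A ~> O) (f : A ~> B) (g : B ~> C)
  (e' : A' ~> O) (f' : A' ~> B') (g' : B' ~> C')
  (e'' : A'' ~> O) (f'' : A'' ~> B'') (g'' : B'' ~> C'')
  (alpha1 : A ~> A') (beta1 : B ~> B') (gamma1 : C ~> C')
  (alpha2 : A' ~> A'') (beta2 : B' ~> B'') (gamma2 : C' ~> C'').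
Hypotheses (row : is_short_exact e f g) (row' : is_short_exact e' f' g')
  (row'' : is_short_exact e'' f'' g'')
  (mor1 : is_complex_morphism e f g e' f' g' alpha1 beta1 gamma1)
  (mor2 : is_complex_morphism e' f' g' e'' f'' g'' alpha2 beta2 gamma2).

Let pbC := regular_pullbacks regC.
Let pbr : is_pullback f e g !_[O] C. Proof. by case: row. Qed.
Let pbr' : is_pullback f' e' g' !_[O] C'. Proof. by case: row'. Qed.
Let pbr'' : is_pullback f'' e'' g'' !_[O] C''. Proof. by case: row''. Qed.
Let gc : is_cover g. Proof. exact: short_exact_cover row. Qed.
Let gc' : is_cover g'. Proof. exact: short_exact_cover row'. Qed.
Let gc'' : is_cover g''. Proof. exact: short_exact_cover row''. Qed.
Let gf : g ∘ f = !_[O] C ∘ e. Proof. by case: row. Qed.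
Let gf' : g' ∘ f' = !_[O] C' ∘ e'. Proof. by case: row'. Qed.
Let gf'' : g'' ∘ f'' = !_[O] C'' ∘ e''. Proof. by case: row''. Qed.
Let ea1 : e' ∘ alpha1 = e. Proof. by case: mor1. Qed.
Let ea2 : e'' ∘ alpha2 = e'. Proof. by case: mor2. Qed.
Let bf1 : beta1 ∘ f = f' ∘ alpha1. Proof. by case: mor1. Qed.
Let bf2 : beta2 ∘ f' = f'' ∘ alpha2. Proof. by case: mor2. Qed.
Let cg1 : gamma1 ∘ g = g' ∘ beta1. Proof. by case: mor1. Qed.
Let cg2 : gamma2 ∘ g' = g'' ∘ beta2. Proof. by case: mor2. Qed.

Lemma left_column_map (a : A ~> O) : is_complex a alpha1 alpha2 -> a = e.
Proof.
move=> ca; rewrite -ea1 -ea2 -comp_assoc ca comp_assoc.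
by rewrite (init_ext (e'' ∘ _) (id O)) comp_id_l.
Qed.

(** With [K] a kernel of [gamma2] and [h : C -> K] the comparison map, both [g] and [h ∘ g] turn out
    to be cokernels of [f], so [h] is invertible. *)
Lemma nine_lemma_right (a : A ~> O) (b : B ~> O) :
  is_short_exact_morphism a alpha1 alpha2 b beta1 beta2 f f' f'' ->
  exists! c : C ~> O,
    is_short_exact_morphism b beta1 beta2 c gamma1 gamma2 g g' g''.
Proof.
move=> [sa sb [ca cb bf _ _]].
have ae := left_column_map ca; rewrite {}ae {a} in sa ca bf.
have [_ pba _] := sa; have [_ pbb _] := sb.
have ac := short_exact_cover sa; have bc := short_exact_cover sb.
have [c cg] : exists c : C ~> O, c ∘ g = b.
  have [_ _ [_ univ]] := row.
  have [|c [[cg _] _]] := univ O b (id O); first by rewrite comp_id_l.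
  by exists c.
have cc : is_complex c gamma1 gamma2.
  apply: (cover_epi regC gc); rewrite -!comp_assoc cg cg1 (comp_eq _ cg2) cb.
  exact: comp_initA.
have g2c : is_cover gamma2.
  apply: (@cover_cancel _ _ _ _ _ g'); rewrite cg2; exact: (cover_comp regC).
exists c; split; last first.
  by move=> d [_ _ [_ _ dg _ _]]; apply: (cover_epi regC gc); rewrite cg dg.
split=> //.
apply: (cover_short_exact regC protoC termT) => //.
have [K [k1 [k2 pbK]]] := pbC gamma2 !_[O] C''; have [sqK _] := pbK.
have [h [h1 h2]] := pullback_lift pbK cc.
(* An element of [K], paired with zero in [B''], lifts locally to [B']; [beta2] kills the lift,
   which therefore comes from [B]. *)
have hgc : is_cover (h ∘ g).
  apply: (cover_of_lift (C := C0)) => W t.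
  have [|W' [k [x [kc x1 x2]]]] := cover_to_pullback regC protoC (esym cg2)
    gc' gf' pbr'' ac bf2 ea2 (z := k1 ∘ t) (y := !_[O] B'' ∘ (k2 ∘ t)).
    by rewrite comp_initA (comp_eq _ sqK).
  have [|l [l1 l2]] := @pullback_lift _ _ _ _ _ _ _ _ _ _ x (k2 ∘ t ∘ k) pbb.
    by rewrite x2 -!comp_assoc.
  exists W', k, l; split=> //; apply: (pullback_ext pbK).
    by rewrite -!comp_assoc (comp_eq1 _ h1) (comp_eq _ cg1) l1 x1 -comp_assoc.
  by rewrite -!comp_assoc (comp_eq1 _ h2) (comp_eq1 _ cg) l2 -comp_assoc.
(* If [h ∘ g] kills [y], then [beta1 ∘ y] comes from an element of [A'] killed by [alpha2], hence
   from [A]. *)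
have [_ _ [_ univ]] : is_short_exact e f (h ∘ g).
- apply: (cover_short_exact regC protoC termT) => //; apply: is_pullback_intro.
  + by rewrite -comp_assoc gf comp_initA.
  + move=> W y z; rewrite -comp_assoc => hy.
    have by_z : b ∘ y = z.
      by rewrite -cg -comp_assoc -(comp_eq1 _ h2) hy comp_to_init.
    have /(pullback_lift pbr') [x' [x1' x2']] : g' ∘ (beta1 ∘ y) = !_[O] C' ∘ z.
      by rewrite -(comp_eq _ cg1) -(comp_eq1 _ h1) hy comp_initA.
    have /(pullback_lift pba) [x [x1 x2]] : alpha2 ∘ x' = !_[O] A'' ∘ z.
      apply: (pullback_ext pbr'').
        by rewrite -(comp_eq _ bf2) x1' (comp_eq _ cb) by_z comp_initA.
      by rewrite (comp_eq1 _ ea2) x2' comp_to_init.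
    exists x; split=> //; apply: (pullback_ext pbb).
      by rewrite (comp_eq _ bf1) x1.
    by rewrite (comp_eq1 _ bf) x2.
  + by move=> W x y; apply: (pullback_ext pbr).
- have [|k [[khg _] _]] := univ _ g !_[O] C; first exact: gf.
  have hi : is_iso h.
    exists k; split.
      by apply: (cover_epi regC gc); rewrite -comp_assoc khg comp_id_l.
    by apply: (cover_epi regC hgc); rewrite -comp_assoc khg comp_id_l.
  by rewrite -h1 -h2; apply: iso_pullback.
Qed.

Lemma nine_lemma_left (b : B ~> O) (c : C ~> O) :
  is_short_exact_morphism b beta1 beta2 c gamma1 gamma2 g g' g'' ->
  exists! a : A ~> O,
    is_short_exact_morphism a alpha1 alpha2 b beta1 beta2 f f' f''.
Proof.
move=> [sb sc [cb cc cg _ _]].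
have [_ pbb _] := sb; have [_ pbc _] := sc.
have bc := short_exact_cover sb.
have bf : b ∘ f = e by rewrite -cg -comp_assoc gf comp_to_init.
have ca : is_complex e alpha1 alpha2.
  apply: (pullback_ext pbr'').
    by rewrite -(comp_eq _ bf2) -bf1 (comp_eq _ cb) bf comp_initA.
  by rewrite (comp_eq1 _ ea2) ea1 comp_to_init.
exists e; split; last by move=> a [_ _ [ca' _ _ _ _]]; rewrite (left_column_map ca').
split=> //; apply: (cover_short_exact regC protoC termT).
(* Here the cover between kernels is [g]. An element of [A''], seen in [B''] and paired with zero in
   [C'], lifts locally to [B'], and the lift lies in the kernel [A'] of [g']. *)
- apply: (cover_of_lift (C := C0)) => W t.
  have [|W' [k [x [kc x1 x2]]]] := cover_to_pullback regC protoC cg2 bc cb pbc gc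
    (esym cg1) cg (z := f'' ∘ t) (y := !_[O] C' ∘ (e'' ∘ t)).
    by rewrite comp_initA (comp_eq _ gf'').
  have [|l [l1 l2]] := @pullback_lift _ _ _ _ _ _ _ _ _ _ x (e'' ∘ t ∘ k) pbr'.
    by rewrite x2 -!comp_assoc.
  exists W', k, l; split=> //; apply: (pullback_ext pbr'').
    by rewrite -(comp_eq _ bf2) l1 x1 comp_assoc.
  by rewrite (comp_eq1 _ ea2) l2 comp_assoc.
- apply: is_pullback_intro => //.
  + move=> W y z yz.
    have /(pullback_lift pbb) [x [x1 x2]] : beta2 ∘ (f' ∘ y) = !_[O] B'' ∘ z.
      by rewrite (comp_eq _ bf2) yz comp_initA.
    have ey : e' ∘ y = z by rewrite -ea2 -comp_assoc yz comp_to_init.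
    have /(pullback_lift pbr) [l [l1 l2]] : g ∘ x = !_[O] C ∘ z.
      apply: (pullback_ext pbc).
        by rewrite (comp_eq _ cg1) x1 (comp_eq _ gf') ey comp_initA.
      by rewrite (comp_eq1 _ cg) x2 comp_to_init.
    exists l; split=> //; apply: (pullback_ext pbr').
      by rewrite -(comp_eq _ bf1) l1.
    by rewrite (comp_eq1 _ ea1) l2.
  + move=> W x y e1 e2; apply: (pullback_ext pbr) => //.
    apply: (pullback_ext pbb); first by rewrite !(comp_eq _ bf1) e1.
    by rewrite !(comp_eq1 _ bf).
Qed.

Lemma nine_lemma_middle (a : A ~> O) (b : B ~> O) (c : C ~> O) :
  is_complex_morphism a alpha1 alpha2 b beta1 beta2 f f' f'' ->
  is_complex_morphism b beta1 beta2 c gamma1 gamma2 g g' g'' ->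
  is_short_exact a alpha1 alpha2 -> is_short_exact c gamma1 gamma2 ->
  is_short_exact b beta1 beta2.
Proof.
move=> [ca cb bf _ _] [_ _ cg _ _] sa sc.
have ae := left_column_map ca; rewrite {}ae {a} in sa ca bf.
have [_ pba _] := sa; have [_ pbc _] := sc.
have ac := short_exact_cover sa; have cc := short_exact_cover sc.
apply: (cover_short_exact regC protoC termT).
  (* Elements of [B''] over [O -> C''] lie in [A''] and lift locally along [alpha2]. *)
  apply: (cover_five (O := O) regC protoC (q := g'')).
    by rewrite -cg2; apply: (cover_comp regC).
  move=> W y t /(pullback_lift pbr'') [x [x1 x2]].
  have [W' [k [l [kc lk]]]] := cover_lift regC x ac.
  exists W', k, (f' ∘ l); split=> //.
  by rewrite (comp_eq _ bf2) lk comp_assoc x1.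
have [K [k1 [k2 pbK]]] := pbC beta2 !_[O] B''; have [sqK _] := pbK.
have [h [h1 h2]] := pullback_lift pbK cb.
(* [g'] carries the kernel [K] of [beta2] into the kernel [C] of [gamma2]. The induced [q] extends
   [g] along [h], so the short five lemma over [C] can compare [B] with [K]. *)
have /(pullback_lift pbc) [q [q1 q2]] : gamma2 ∘ (g' ∘ k1) = !_[O] C'' ∘ k2.
  by rewrite (comp_eq _ cg2) sqK comp_initA.
have qh : q ∘ h = g.
  apply: (pullback_ext pbc); first by rewrite (comp_eq1 _ q1) -comp_assoc h1 cg1.
  by rewrite (comp_eq1 _ q2) h2 cg.
rewrite -h1 -h2; apply: iso_pullback => //.
apply: (short_five (O := O) regC protoC (q := q)); first by rewrite qh.
move=> W y t qt.
have k2t : k2 ∘ t = y by rewrite -q2 -comp_assoc qt comp_to_init.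
have /(pullback_lift pbr') [x' [x1' x2']] : g' ∘ (k1 ∘ t) = !_[O] C' ∘ y.
  by rewrite -(comp_eq _ q1) qt comp_initA.
have /(pullback_lift pba) [x [x1 x2]] : alpha2 ∘ x' = !_[O] A'' ∘ y.
  apply: (pullback_ext pbr'').
    by rewrite -(comp_eq _ bf2) x1' (comp_eq _ sqK) k2t comp_initA.
  by rewrite (comp_eq1 _ ea2) x2' comp_to_init.
have hfx : h ∘ (f ∘ x) = t.
  apply: (pullback_ext pbK); first by rewrite (comp_eq1 _ h1) (comp_eq _ bf1) x1.
  by rewrite (comp_eq1 _ h2) (comp_eq1 _ bf) x2.
exists (f ∘ x); split=> // s hs.
(* Any other lift [s] is killed by [g], so it comes from some [z] in [A], and [z = x] is tested
   after [alpha1] and [f']. *)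
have /(pullback_lift pbr) [z [z1 z2]] : g ∘ s = !_[O] C ∘ y.
  by rewrite -qh -comp_assoc hs.
rewrite -z1; congr (f ∘ _); apply: (pullback_ext pba); last by rewrite x2.
apply: (pullback_ext pbr'); last by rewrite !(comp_eq1 _ ea1) x2.
by rewrite -!(comp_eq _ bf1) z1 -h1 -!comp_assoc hs hfx.
Qed.
End NineLemma.

Theorem theorem5p10 (Acat : category) (HA : prohomological Acat)
  (O : initial_object Acat)
  (A B C A' B' C' A'' B'' C'' : Acat)
  (e : A ~> O) (f : A ~> B) (g : B ~> C)
  (e' : A' ~> O) (f' : A' ~> B') (g' : B' ~> C')
  (e'' : A'' ~> O) (f'' : A'' ~> B'') (g'' : B'' ~> C'')
  (hrow : is_short_exact e f g)
  (hrow' : is_short_exact e' f' g')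
  (hrow'' : is_short_exact e'' f'' g'')
  (alpha1 : A ~> A') (beta1 : B ~> B') (gamma1 : C ~> C')
  (alpha2 : A' ~> A'') (beta2 : B' ~> B'') (gamma2 : C' ~> C'')
  (hmor1 : is_complex_morphism e f g e' f' g' alpha1 beta1 gamma1)
  (hmor2 : is_complex_morphism e' f' g' e'' f'' g'' alpha2 beta2 gamma2) :
  (forall (a : A ~> O) (b : B ~> O),
     is_short_exact_morphism a alpha1 alpha2 b beta1 beta2 f f' f'' ->
     exists! c : C ~> O,
       is_short_exact_morphism b beta1 beta2 c gamma1 gamma2 g g' g'') /\
  (forall (b : B ~> O) (c : C ~> O),
     is_short_exact_morphism b beta1 beta2 c gamma1 gamma2 g g' g'' ->
     exists! a : A ~> O,
       is_short_exact_morphism a alpha1 alpha2 b beta1 beta2 f f' f'') /\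
  (forall (a : A ~> O) (b : B ~> O) (c : C ~> O),
     is_complex_morphism a alpha1 alpha2 b beta1 beta2 f f' f'' ->
     is_complex_morphism b beta1 beta2 c gamma1 gamma2 g g' g'' ->
     is_short_exact a alpha1 alpha2 ->
     is_short_exact c gamma1 gamma2 ->
     is_short_exact b beta1 beta2).
Proof.
have [[_ [_ [T [termT _]]]] regC protoC] := HA.
split; [|split].
- move=> a b; exact: (nine_lemma_right regC protoC termT hrow hrow' hrow'').
- move=> b c; exact: (nine_lemma_left regC protoC termT hrow hrow' hrow'').
- move=> a b c; exact: (nine_lemma_middle regC protoC termT hrow hrow' hrow'').
Qed.
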